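(* Let $q\in\mathrm{Var}$ be a variable, and let $\tau^+$, $\tau^-$ be the translations (defined in the context, using $q$) from formulae (and, for $\tau^-$, meta-formulae) of $\mathbf{Lb}^{*}_{\mathbf{1}}$ to those of $\mathbf{Lb}^{*}$. For any $\mathbf{Lb}^{*}_{\mathbf{1}}$-sequent $\Pi\to C$ that has no occurrences of $q$, the sequent $\Pi\to C$ is derivable in $\mathbf{Lb}^{*}_{\mathbf{1}}$ if and only if the sequent $\tau^-(\Pi)\to\tau^+(C)$ is derivable in $\mathbf{Lb}^{*}$.
   Context: **Syntax.** Formulae of $\mathbf{Lb}^{*}$ are built from variables $\mathrm{Var}=\{p_1,p_2,\dots\}$ using binary connectives $\backslash$, $/$, $\cdot$ and unary connectives $\langle\rangle$, $[]^{-1}$. Formulae of $\mathbf{Lb}^{*}_{\mathbf{1}}$ are built in the same way, but the constant $\mathbf{1}$ is also allowed as an atomic formula. Meta-formulae are built from formulae using comma and brackets $[\dots]$; comma is associative and the empty meta-formula $\Lambda$ is its unit ($\Gamma,\Lambda$ and $\Lambda,\Gamma$ are identified with $\Gamma$). A sequent is $\Pi\to C$ with $\Pi$ a meta-formula and $C$ a formula. $\Delta(\Pi)$ denotes a meta-formula $\Delta$ with a designated occurrence of a sub-meta-formula $\Pi$, and $\Delta(\Pi')$ then denotes the result of replacing that occurrence by $\Pi'$. **Calculus $\mathbf{Lb}^{*}$.** Axioms: $p_i\to p_i$ for each variable. Rules (premises above the line, conclusion below; there is no cut rule): $$\frac{\Pi\to A\quad \Delta(B)\to C}{\Delta(\Pi,A\backslash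 B)\to C}(\backslash\to)\qquad \frac{A,\Pi\to B}{\Pi\to A\backslash B}(\to\backslash)$$ $$\frac{\Pi\to A\quad \Delta(B)\to C}{\Delta(B/A,\Pi)\to C}(/\to)\qquad \frac{\Pi,A\to B}{\Pi\to B/A}(\to/)$$ $$\frac{\Delta(A,B)\to C}{\Delta(A\cdot B)\to C}(\cdot\to)\qquad \frac{\Pi\to A\quad \Gamma\to B}{\Pi,\Gamma\to A\cdot B}(\to\cdot)$$ $$\frac{\Delta([A])\to C}{\Delta(\langle\rangle A)\to C}(\langle\rangle\to)\qquad \frac{\Pi\to A}{[\Pi]\to\langle\rangle A}(\to\langle\rangle)$$ $$\frac{\Delta(A)\to C}{\Delta([[]^{-1}A])\to C}([]^{-1}\to)\qquad \frac{[\Pi]\to A}{\Pi\to []^{-1}A}(\to[]^{-1})$$ Antecedents (and the contents of brackets) may be empty. **Calculus $\mathbf{Lb}^{*}_{\mathbf{1}}$.** The same axioms and rules, over formulae that may contain $\mathbf{1}$, plus the rule $$\frac{\Delta(\Lambda)\to C}{\Delta(\mathbf{1})\to C}(\mathbf{1}\to)$$ and the axiom $(\to\mathbf{1})$: $\ \Lambda\to\mathbf{1}$. **Translations.** For formulae without $q$, define $\tau^+$ and $\tau^-$ by joint induction, where $p_i$ ranges over variables other than $q$: - $\tau^+(\mathbf{1})=\tau^-(\mathbf{1})=q\backslash q$; - $\tau^+(p_i)=(q\backslash q)\cdot p_i\cdot(q\backslash q)$, $\ \tau^-(p_i)=p_i$; - $\tau^+(A\backslash B)=\tau^-(A)\backslash\tau^+(B)$,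 $\ \tau^-(A\backslash B)=\tau^+(A)\backslash\tau^-(B)$; - $\tau^+(B/A)=\tau^+(B)/\tau^-(A)$, $\ \tau^-(B/A)=\tau^-(B)/\tau^+(A)$; - $\tau^+(A\cdot B)=\tau^+(A)\cdot\tau^+(B)$, $\ \tau^-(A\cdot B)=\tau^-(A)\cdot\tau^-(B)$; - $\tau^+(\langle\rangle A)=(q\backslash q)\cdot\langle\rangle\tau^+(A)\cdot(q\backslash q)$, $\ \tau^-(\langle\rangle A)=\langle\rangle\tau^-(A)$; - $\tau^+([]^{-1}A)=[]^{-1}\tau^+(A)$, $\ \tau^-([]^{-1}A)=(q\backslash q)\backslash\,[]^{-1}\tau^-(A)\,/(q\backslash q)$. Here $X\cdot Y\cdot Z$ is read as $(X\cdot Y)\cdot Z$ and $X\backslash Y/Z$ as $(X\backslash Y)/Z$ (the other bracketing gives an equivalent formula in each case). For meta-formulae: $\tau^-(\Lambda)=\Lambda$, $\tau^-(\Gamma,\Delta)=\tau^-(\Gamma),\tau^-(\Delta)$, $\tau^-([\Gamma])=[\tau^-(\Gamma)]$. *)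

(* Defs.v *)
From mathcomp Require Import all_boot.

Set Implicit Arguments.
Unset Strict Implicit.
Unset Printing Implicit Defensive.

(* [u] says whether the constant 1 belongs to the language: [One] needs a proof
   of [u], so [formula false] has no constant at all. Variables are indexed by
   natural numbers. *)
Inductive formula (u : bool) : Type :=
| Var of nat
| One of u
| Under of formula u & formula u  (* Under A B is A \ B *)
| Over of formula u & formula u   (* Over B A is B / A *)
| Prod of formula u & formula u   (* Prod A B is A . B *)
| Dia of formula u                (* Dia A is <> A *)
| BoxInv of formula u.            (* BoxInv A is []^{-1} A *)

(* A meta-formula is a list of items, each a formula or a bracketed
   meta-formula; comma is concatenation, so that associativity and the unit
   laws for the empty meta-formula [::] hold as equalities. *)
Inductive item (u : bool) : Type :=
| Fm of formula u
| Br of seq (item u).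

Notation meta u := (seq (item u)).

(* A meta-formula Delta( ) with one designated place. *)
Inductive context (u : bool) : Type :=
| Hole of meta u & meta u
| InBr of meta u & context u & meta u.

Fixpoint plug (u : bool) (D : context u) (P : meta u) : meta u :=
  match D with
  | Hole L R => L ++ P ++ R
  | InBr L D' R => L ++ Br (plug D' P) :: R
  end.

(* The last two clauses need a proof of [u], hence are void for [u = false]. *)
Inductive derivable (u : bool) : meta u -> formula u -> Prop :=
| Ax i :
    derivable [:: Fm (Var u i)] (Var u i)
| UnderL D P A B C :
    derivable P A -> derivable (plug D [:: Fm B]) C ->
    derivable (plug D (P ++ [:: Fm (Under A B)])) C
| UnderR P A B :
    derivable (Fm A :: P) B -> derivable P (Under A B)
| OverL D P A B C :
    derivable P A -> derivable (plug D [:: Fm B]) C ->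
    derivable (plug D (Fm (Over B A) :: P)) C
| OverR P A B :
    derivable (P ++ [:: Fm A]) B -> derivable P (Over B A)
| ProdL D A B C :
    derivable (plug D [:: Fm A; Fm B]) C ->
    derivable (plug D [:: Fm (Prod A B)]) C
| ProdR P G A B :
    derivable P A -> derivable G B -> derivable (P ++ G) (Prod A B)
| DiaL D A C :
    derivable (plug D [:: Br [:: Fm A]]) C ->
    derivable (plug D [:: Fm (Dia A)]) C
| DiaR P A :
    derivable P A -> derivable [:: Br P] (Dia A)
| BoxInvL D A C :
    derivable (plug D [:: Fm A]) C ->
    derivable (plug D [:: Br [:: Fm (BoxInv A)]]) C
| BoxInvR P A :
    derivable [:: Br P] A -> derivable P (BoxInv A)
| OneL (h : u) D C :
    derivable (plug D [::]) C -> derivable (plug D [:: Fm (One h)]) C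
| OneR (h : u) :
    derivable [::] (One h).

Definition derivable_Lb : meta false -> formula false -> Prop :=
  @derivable false.
Definition derivable_Lb1 : meta true -> formula true -> Prop :=
  @derivable true.

Fixpoint occurs (u : bool) (q : nat) (A : formula u) : bool :=
  match A with
  | Var i => i == q
  | One _ => false
  | Under A B | Over A B | Prod A B => occurs q A || occurs q B
  | Dia A | BoxInv A => occurs q A
  end.

Fixpoint occurs_item (u : bool) (q : nat) (X : item u) : bool :=
  match X with
  | Fm A => occurs q A
  | Br G => has (occurs_item q) G
  end.

Definition occurs_meta (u : bool) (q : nat) (G : meta u) : bool :=
  has (occurs_item q) G.

Definition qq (q : nat) : formula false := Under (Var false q) (Var false q).

(* Both translations are total for convenience; they are meaningful only on
   formulae in which [q] does not occur. *)
Fixpoint tau_pos (q : nat) (A : formula true) : formula false :=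
  match A with
  | Var i => Prod (Prod (qq q) (Var false i)) (qq q)
  | One _ => qq q
  | Under A B => Under (tau_neg q A) (tau_pos q B)
  | Over B A => Over (tau_pos q B) (tau_neg q A)
  | Prod A B => Prod (tau_pos q A) (tau_pos q B)
  | Dia A => Prod (Prod (qq q) (Dia (tau_pos q A))) (qq q)
  | BoxInv A => BoxInv (tau_pos q A)
  end
with tau_neg (q : nat) (A : formula true) : formula false :=
  match A with
  | Var i => Var false i
  | One _ => qq q
  | Under A B => Under (tau_pos q A) (tau_neg q B)
  | Over B A => Over (tau_neg q B) (tau_pos q A)
  | Prod A B => Prod (tau_neg q A) (tau_neg q B)
  | Dia A => Dia (tau_neg q A)
  | BoxInv A => Over (Under (qq q) (BoxInv (tau_neg q A))) (qq q)
  end.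

Fixpoint tau_neg_item (q : nat) (X : item true) : item false :=
  match X with
  | Fm A => Fm (tau_neg q A)
  | Br G => Br (map (tau_neg_item q) G)
  end.

Definition tau_neg_meta (q : nat) (G : meta true) : meta false :=
  map (tau_neg_item q) G.

(* Main.v *)
(** From left to right, one inserts arbitrarily many copies of [q \ q] anywhere
    in the antecedent: every rule of Lb*1 survives this insertion after
    translation, because the copies reaching a variable, a bracket or a
    []^{-1} are absorbed by the factors [q \ q] which the translation adds.
    From right to left, one reads [q] as the empty meta-formula in antecedents
    and as [1] in succedents, and the intermediate subformulae of a translation
    as the formula translated; the only cuts this requires are on [1], and
    those are admissible by a direct induction. *)
Require Import Defs.
From mathcomp Require Import all_boot.

Set Implicit Arguments.
Unset Strict Implicit.
Unset Printing Implicit Defensive.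

(** * Composition of contexts and admissibility of cut on the constant *)

Fixpoint context_comp (u : bool) (D E : context u) : context u :=
  match D with
  | Hole L R =>
      match E with
      | Hole L' R' => Hole (L ++ L') (R' ++ R)
      | InBr L' E' R' => InBr (L ++ L') E' (R' ++ R)
      end
  | InBr L D' R => InBr L (context_comp D' E) R
  end.

Lemma plug_comp (u : bool) (D E : context u) (P : meta u) :
  plug (context_comp D E) P = plug D (plug E P).
Proof.
elim: D => [L R|L D IH R] /=; last by rewrite IH.
by case: E => [L' R'|L' E' R'] /=; rewrite -!catA.
Qed.

Lemma plug_cat (u : bool) (D : context u) (L R P : meta u) :
  plug D (L ++ P ++ R) = plug (context_comp D (Hole L R)) P.
Proof. by rewrite plug_comp. Qed.

Lemma plug_Br (u : bool) (D : context u) (L R P : meta u) :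
  plug D (L ++ Br P :: R) =
  plug (context_comp D (InBr L (Hole [::] [::]) R)) P.
Proof. by rewrite plug_comp /= cats0. Qed.

(** Induction on the derivation of [P -> 1] alone. It can end only in a left rule, which is replayed
    inside [D], or in [OneR], where [P] is empty and the second premise is the goal. *)
Lemma cut_One (u : bool) (h : u) (P : meta u) (D : context u) (C : formula u) :
  derivable P (One h) -> derivable (plug D [::]) C -> derivable (plug D P) C.
Proof.
move E: (One h) => F dP dC; move: E.
elim: dP => {P F} //.
- move=> D' P A B F dP _ _ IH /IH; rewrite -!plug_comp; exact: UnderL.
- move=> D' P A B F dP _ _ IH /IH; rewrite -!plug_comp; exact: OverL.
- move=> D' A B F _ IH /IH; rewrite -!plug_comp; exact: ProdL.
- move=> D' A F _ IH /IH; rewrite -!plug_comp; exact: DiaL.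
- move=> D' A F _ IH /IH; rewrite -!plug_comp; exact: BoxInvL.
- move=> h' D' F _ IH /IH; rewrite -!plug_comp; exact: OneL.
Qed.

(** * Matching meta-formulae up to skipped formulae *)

(** One relation serves both directions: [N] pairs formulae in corresponding places, [Sl] and [Sr]
    tell which formulae may be skipped on the left and on the right, and brackets must correspond.
    Skipping [qq q] on the right gives insertion; skipping [q] on the left gives erasure. *)
Inductive match_meta (u v : bool) (N : formula u -> formula v -> Prop)
  (Sl : formula u -> Prop) (Sr : formula v -> Prop) : meta u -> meta v -> Prop :=
| MatchNil : match_meta N Sl Sr [::] [::]
| MatchSkipL F G M : Sl F -> match_meta N Sl Sr G M ->
    match_meta N Sl Sr (Fm F :: G) M
| MatchSkipR F G M : Sr F -> match_meta N Sl Sr G M ->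
    match_meta N Sl Sr G (Fm F :: M)
| MatchFm F F' G M : N F F' -> match_meta N Sl Sr G M ->
    match_meta N Sl Sr (Fm F :: G) (Fm F' :: M)
| MatchBr H H' G M : match_meta N Sl Sr H H' -> match_meta N Sl Sr G M ->
    match_meta N Sl Sr (Br H :: G) (Br H' :: M).

Lemma match_sym (u v : bool) (N : formula u -> formula v -> Prop) Sl Sr G M :
  match_meta N Sl Sr G M -> match_meta (fun F' F => N F F') Sr Sl M G.
Proof.
by elim=> *; [exact: MatchNil | exact: MatchSkipR | exact: MatchSkipL
             | exact: MatchFm | exact: MatchBr].
Qed.

Section Match.
Variables (u v : bool) (N : formula u -> formula v -> Prop).
Variables (Sl : formula u -> Prop) (Sr : formula v -> Prop).
Local Notation rel := (match_meta N Sl Sr).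

Lemma match_cat G1 G2 M1 M2 : rel G1 M1 -> rel G2 M2 -> rel (G1 ++ G2) (M1 ++ M2).
Proof.
move=> r1 r2; elim: r1 => //= *; [exact: MatchSkipL | exact: MatchSkipR
  | exact: MatchFm | exact: MatchBr].
Qed.

Lemma match_cat_inv G1 G2 M : rel (G1 ++ G2) M ->
  exists M1 M2, [/\ M = M1 ++ M2, rel G1 M1 & rel G2 M2].
Proof.
move E: (G1 ++ G2) => G r; elim: r G1 E => {G M}.
- by case=> //= ->; exists [::], [::]; split=> //; exact: MatchNil.
- move=> F G M sF r IH [|X G1] /= E.
    by exists [::], M; split=> //; [exact: MatchNil | rewrite E; exact: MatchSkipL].
  case: E => -> /IH [M1 [M2 [-> r1 r2]]].
  by exists M1, M2; split=> //; exact: MatchSkipL.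
- move=> F G M sF r IH G1 /IH [M1 [M2 [-> r1 r2]]].
  by exists (Fm F :: M1), M2; split=> //; exact: MatchSkipR.
- move=> F F' G M nF r IH [|X G1] /= E.
    exists [::], (Fm F' :: M); split=> //; first exact: MatchNil.
    by rewrite E; exact: MatchFm.
  case: E => -> /IH [M1 [M2 [-> r1 r2]]].
  by exists (Fm F' :: M1), M2; split=> //; exact: MatchFm.
- move=> H H' G M rH _ r IH [|X G1] /= E.
    exists [::], (Br H' :: M); split=> //; first exact: MatchNil.
    by rewrite E; exact: MatchBr.
  case: E => -> /IH [M1 [M2 [-> r1 r2]]].
  by exists (Br H' :: M1), M2; split=> //; exact: MatchBr.
Qed.

Lemma match_Fm_inv F G M : rel (Fm F :: G) M ->
  (Sl F /\ rel G M) \/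
  exists K F' M', [/\ M = K ++ Fm F' :: M', rel [::] K, N F F' & rel G M'].
Proof.
move E: (Fm F :: G) => G0 r; elim: r E => {G0 M} //.
- by move=> F0 G0 M sF r _ [-> ->]; left.
- move=> F0 G0 M sF r IH /IH [[sF' r']|[K [F' [M' [-> rK nF rG]]]]].
    by left; split=> //; exact: MatchSkipR.
  by right; exists (Fm F0 :: K), F', M'; split=> //; exact: MatchSkipR.
- move=> F0 F' G0 M nF r _ [-> ->]; right.
  by exists [::], F', M; split=> //; exact: MatchNil.
Qed.

Lemma match_Br_inv H G M : rel (Br H :: G) M ->
  exists K H' M', [/\ M = K ++ Br H' :: M', rel [::] K, rel H H' & rel G M'].
Proof.
move E: (Br H :: G) => G0 r; elim: r E => {G0 M} //.
- move=> F0 G0 M sF r IH /IH [K [H' [M' [-> rK rH rG]]]].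
  by exists (Fm F0 :: K), H', M'; split=> //; exact: MatchSkipR.
- move=> H0 H' G0 M rH _ r _ [-> ->].
  by exists [::], H', M; split=> //; exact: MatchNil.
Qed.

(** Transfers a match from the conclusion of a left rule to its premise: the context [D'] found for
    the conclusion accepts any other matched pair in its hole. *)
Lemma match_plug_inv D P M : rel (plug D P) M ->
  exists D' P', [/\ M = plug D' P', rel P P' &
    forall Q Q', rel Q Q' -> rel (plug D Q) (plug D' Q')].
Proof.
elim: D M => [L R|L D IH R] M /=.
- move=> /match_cat_inv [L' [M0 [-> rL]]].
  move=> /match_cat_inv [P' [R' [-> rP rR]]].
  exists (Hole L' R'), P'; split=> // Q Q' rQ.
  by apply: match_cat => //; exact: match_cat.
- move=> /match_cat_inv [L' [M0 [-> rL]]].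
  move=> /match_Br_inv [K [H' [R' [-> rK]]]] /IH [D' [P' [-> rP rD]]] rR.
  (* The skipped formulae [K] in front of the bracket join the left part of the context. *)
  exists (InBr (L' ++ K) D' R'), P'; split=> //; first by rewrite /= -catA.
  move=> Q Q' rQ /=; rewrite -[L]cats0.
  apply: match_cat; first exact: match_cat.
  by apply: MatchBr => //; exact: rD.
Qed.

Lemma match_nil_inv M : (forall F, ~ Sr F) -> rel [::] M -> M = [::].
Proof.
move=> nS; move E: [::] => G r; by elim: r E => // F G0 M0 /nS.
Qed.

End Match.

(** The generated principle for [item] gives no hypothesis on the contents of a bracket, since these
    sit inside a [seq]; hence the explicit nested fixpoint. *)
Lemma item_nested_ind (u : bool) (P : item u -> Prop) (Q : meta u -> Prop) :
  (forall A, P (Fm A)) -> (forall G, Q G -> P (Br G)) ->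
  Q [::] -> (forall X G, P X -> Q G -> Q (X :: G)) -> forall G, Q G.
Proof.
move=> hF hB h0 hS.
have hP : forall X, P X.
  fix IH 1; case=> [A|G]; first exact: hF.
  apply: hB; elim: G => [|X G IHG]; [exact: h0 | exact: hS (IH X) IHG].
by elim=> [|X G IHG]; [exact: h0 | exact: hS].
Qed.

(** The translation is a match that skips nothing; this is the starting point of both directions. *)
Lemma match_tau (q : nat) N Sl Sr (Pi : meta true) :
  (forall A, ~~ occurs q A -> N A (tau_neg q A)) ->
  ~~ occurs_meta q Pi -> match_meta N Sl Sr Pi (tau_neg_meta q Pi).
Proof.
move=> hN; move: Pi.
apply: (@item_nested_ind _ (fun X => ~~ occurs_item q X -> forall G M,
  match_meta N Sl Sr G M -> match_meta N Sl Sr (X :: G) (tau_neg_item q X :: M))).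
- by move=> A /hN nA G M; exact: MatchFm.
- by move=> G IH /IH rG G' M; exact: MatchBr.
- by move=> _; exact: MatchNil.
- by move=> X G hX hG; rewrite /occurs_meta /= negb_or => /andP[/hX h /hG]; exact: h.
Qed.

(** * From left to right: inserting copies of q \ q *)

Section Insertion.
Variable q : nat.

Definition ins : meta true -> meta false -> Prop :=
  match_meta (fun A F => F = tau_neg q A) (fun _ => False) (fun F => F = qq q).

(** Here [K] consists of copies of q \ q only. Once [q] stands in front of them, each copy in turn
    consumes it and gives it back. *)
Lemma ins_nil_qq K : ins [::] K -> derivable K (qq q).
Proof.
move=> r; apply: UnderR; move E: [::] r => G r.
elim: r E => {G K} // [_|F G K -> _ IH /IH dK]; first exact: Ax.
exact: (@UnderL _ (Hole [::] K) [:: Fm (Var false q)]) (Ax _ _) dK.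
Qed.

Lemma ins_Fm_inv A G M : ins (Fm A :: G) M ->
  exists K M', [/\ M = K ++ Fm (tau_neg q A) :: M', ins [::] K & ins G M'].
Proof. by case/match_Fm_inv=> [[]|[K [_ [M' [-> rK -> rM]]]]] //; exists K, M'. Qed.

(** The copies adjacent to the designated formula are pushed into the context, so that its
    translation stands alone in the hole, as the one-premise left rules require. *)
Lemma ins_plug_Fm_inv D A M : ins (plug D [:: Fm A]) M ->
  exists2 D', M = plug D' [:: Fm (tau_neg q A)] &
    forall P P', ins P P' -> ins (plug D P) (plug D' P').
Proof.
case/match_plug_inv=> D' [_ [-> /ins_Fm_inv [K [K' [-> rK rK']]] rD]].
exists (context_comp D' (Hole K K')); first by rewrite plug_comp.
move=> P P' rP; rewrite plug_comp /=; apply: rD.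
rewrite -[P]cats0; apply: (@match_cat _ _ _ _ _ [::]) => //; exact: match_cat.
Qed.

(** Arbitrary insertions are what makes the induction work: in the case of [OneL] the translated
    constant is just one more inserted copy. *)
Lemma derivable_ins Pi C M :
  derivable Pi C -> ins Pi M -> derivable M (tau_pos q C).
Proof.
(* For variables and diamonds in the succedent: the outer factors absorb the copies on either
   side. *)
have qqs F K K' G : ins [::] K -> ins [::] K' -> derivable G F ->
    derivable (K ++ G ++ K') (Prod (Prod (qq q) F) (qq q)).
  move=> rK rK' dG; rewrite catA.
  by do ! [apply: ProdR => //; try exact: ins_nil_qq].
move=> d; elim: d M => {Pi C}.
- move=> i M /ins_Fm_inv [K [K' [-> rK rK']]].
  by apply: (@qqs _ _ _ [:: _]) => //; exact: Ax.
- move=> D P A B C _ IHA _ IHB M /match_plug_inv [D' [X [-> + rD]]].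
  case/match_cat_inv=> P' [_ [-> rP /ins_Fm_inv [K [K' [-> rK rK']]]]].
  (* The copies [K] before the implication go to the argument [P']; the copies [K'] after it stay
     beside [B]. *)
  rewrite catA -cat1s catA -[_ ++ K']cat0s plug_cat.
  apply: UnderL.
    by apply: IHA; rewrite -[P]cats0; exact: match_cat.
  rewrite plug_comp /=; apply/IHB/rD.
  exact: MatchFm.
- by move=> P A B _ IH M r; apply/UnderR/IH; exact: MatchFm.
- move=> D P A B C _ IHA _ IHB M /match_plug_inv [D' [X [-> + rD]]].
  move=> /ins_Fm_inv [K [P' [-> rK rP]]].
  rewrite -[_ :: P']cats0 plug_cat.
  apply: OverL; first exact: IHA.
  rewrite plug_comp /=; apply/IHB/rD.
  apply: (@match_cat _ _ _ _ _ [::]) => //; apply: MatchFm => //; exact: MatchNil.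
- move=> P A B _ IH M r; apply/OverR/IH; apply: match_cat => //.
  by apply: MatchFm => //; exact: MatchNil.
- move=> D A B C _ IH M /ins_plug_Fm_inv [D' -> rD].
  apply/ProdL/IH/rD; do 2 apply: MatchFm => //; exact: MatchNil.
- move=> P G A B _ IHA _ IHB M /match_cat_inv [P' [G' [-> /IHA dA /IHB dB]]].
  exact: ProdR.
- move=> D A C _ IH M /ins_plug_Fm_inv [D' -> rD].
  apply/DiaL/IH/rD; apply: MatchBr; last exact: MatchNil.
  by apply: MatchFm => //; exact: MatchNil.
- move=> P A _ IH M /match_Br_inv [K [P' [K' [-> rK /IH dP rK']]]].
  by apply: (@qqs _ _ _ [:: _]) => //; exact: DiaR.
- move=> D A C _ IH M /match_plug_inv [D' [X [-> + rD]]].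
  case/match_Br_inv=> K [_ [K' [-> rK /ins_Fm_inv [L [L' [-> rL rL']]] rK']]].
  (* Inside the bracket, [L'] is consumed by the right argument of the translation and [L] by the
     left one; [BoxInvL] then finds its formula alone there. *)
  rewrite plug_Br -[_ :: L']cats0 plug_cat.
  apply: OverL; first exact: ins_nil_qq.
  rewrite plug_comp /=; apply: UnderL; first exact: ins_nil_qq.
  rewrite -plug_Br -cat1s plug_cat; apply: BoxInvL.
  rewrite plug_comp /=; apply/IH/rD.
  by apply: (@match_cat _ _ _ _ _ [::]) => //; exact: MatchFm.
- by move=> P A _ IH M r; apply/BoxInvR/IH; apply: MatchBr => //; exact: MatchNil.
- move=> h D C _ IH M /ins_plug_Fm_inv [D' -> rD].
  by apply/IH/rD; apply: MatchSkipR => //; exact: MatchNil.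
- by move=> h M; exact: ins_nil_qq.
Qed.

End Insertion.

(** * From right to left: erasing [q] *)

Section Erasure.
Variable q : nat.

(** Besides full translations, this covers the stages met while the two arguments q \ q of a
    translated []^{-1}-formula are being removed. *)
Inductive neg_erase : formula false -> formula true -> Prop :=
| NegTau A : ~~ occurs q A -> neg_erase (tau_neg q A) A
| NegUnder A : ~~ occurs q A ->
    neg_erase (Under (qq q) (BoxInv (tau_neg q A))) (BoxInv A)
| NegBox A : ~~ occurs q A -> neg_erase (BoxInv (tau_neg q A)) (BoxInv A).

(** Besides full translations and [q] read as 1, this covers the stages met while the factors q \ q
    around a variable or a diamond are being split off. *)
Inductive pos_erase : formula false -> formula true -> Prop :=
| PosTau A : ~~ occurs q A -> pos_erase (tau_pos q A) A
| PosQ h : pos_erase (Var false q) (One h)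
| PosVar i : i != q -> pos_erase (Var false i) (Var true i)
| PosProdVar i : i != q -> pos_erase (Prod (qq q) (Var false i)) (Var true i)
| PosDia A : ~~ occurs q A -> pos_erase (Dia (tau_pos q A)) (Dia A)
| PosProdDia A : ~~ occurs q A ->
    pos_erase (Prod (qq q) (Dia (tau_pos q A))) (Dia A).

Definition erase : meta false -> meta true -> Prop :=
  match_meta neg_erase (fun F => F = Var false q) (fun _ => False).

Lemma erase_nil_inv M : erase [::] M -> M = [::].
Proof. by apply: match_nil_inv => F. Qed.

Lemma erase_Fm_inv F G M : F <> Var false q -> erase (Fm F :: G) M ->
  exists A M', [/\ M = Fm A :: M', neg_erase F A & erase G M'].
Proof.
move=> nF /match_Fm_inv [[/nF //]|[K [A [M' [-> /erase_nil_inv -> nA r]]]]].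
by exists A, M'.
Qed.

Lemma erase_Br_inv H G M : erase (Br H :: G) M ->
  exists H' M', [/\ M = Br H' :: M', erase H H' & erase G M'].
Proof.
move=> /match_Br_inv [K [H' [M' [-> /erase_nil_inv -> rH r]]]].
by exists H', M'.
Qed.

Lemma erase_Fm F A : neg_erase F A -> erase [:: Fm F] [:: Fm A].
Proof. by move=> nF; apply: MatchFm => //; exact: MatchNil. Qed.

Lemma erase_q : erase [:: Fm (Var false q)] [::].
Proof. by apply: MatchSkipL => //; exact: MatchNil. Qed.

Lemma erase_plug_Fm_inv D F M : F <> Var false q -> erase (plug D [:: Fm F]) M ->
  exists D' A, [/\ M = plug D' [:: Fm A], neg_erase F A &
    forall P P', erase P P' -> erase (plug D P) (plug D' P')].
Proof.
move=> nF /match_plug_inv [D' [X [-> /(erase_Fm_inv nF)]]].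
by move=> [A [_ [-> nA /erase_nil_inv ->]]] rD; exists D', A.
Qed.

Lemma pos_erase_q C : pos_erase (Var false q) C -> exists h, C = One h.
Proof.
move E: (Var false q) => F pF; case: pF E => //; first by case=> /=.
  by move=> h _; exists h.
by move=> i /eqP ni [/esym].
Qed.

Lemma pos_erase_qq h : pos_erase (qq q) (One h).
Proof. exact: (@PosTau (One h)). Qed.

(** The three origins are a translated implication, the translation of 1, and a half-opened
    []^{-1}-formula. *)
Lemma neg_erase_Under A B F : neg_erase (Under A B) F ->
  [\/ exists A' B', [/\ F = Under A' B', pos_erase A A' & neg_erase B B'],
      exists h, [/\ F = One h, A = Var false q & B = Var false q] |
      A = qq q /\ neg_erase B F].
Proof.
move E: (Under A B) => G nG; case: nG E => //.
- case=> //=.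
    by move=> h _ [-> ->]; apply: Or32; exists h.
  move=> A' B'; rewrite negb_or => /andP[hA hB] [-> ->]; apply: Or31.
  by exists A', B'; split=> //; [exact: PosTau | exact: NegTau].
- by move=> A' hA [-> ->]; apply: Or33; split=> //; exact: NegBox.
Qed.

Lemma neg_erase_Over A B F : neg_erase (Over B A) F ->
  (exists A' B', [/\ F = Over B' A', pos_erase A A' & neg_erase B B']) \/
  (A = qq q /\ neg_erase B F).
Proof.
move E: (Over B A) => G nG; case: nG E => //; case=> //=.
- move=> B' A'; rewrite negb_or => /andP[hB hA] [-> ->]; left.
  by exists A', B'; split=> //; [exact: PosTau | exact: NegTau].
- by move=> A' hA [-> ->]; right; split=> //; exact: NegUnder.
Qed.

Lemma pos_erase_Prod A B F : pos_erase (Prod A B) F ->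
  [\/ exists A' B', [/\ F = Prod A' B', pos_erase A A' & pos_erase B B'],
      A = qq q /\ pos_erase B F | B = qq q /\ pos_erase A F].
Proof.
move E: (Prod A B) => G pG; case: pG E => //.
- case=> //=.
  + by move=> i hi [-> ->]; apply: Or33; split=> //; exact: PosProdVar.
  + move=> A' B'; rewrite negb_or => /andP[hA hB] [-> ->]; apply: Or31.
    by exists A', B'; split=> //; exact: PosTau.
  + by move=> A' hA [-> ->]; apply: Or33; split=> //; exact: PosProdDia.
- by move=> i hi [-> ->]; apply: Or32; split=> //; exact: PosVar.
- by move=> A' hA [-> ->]; apply: Or32; split=> //; exact: PosDia.
Qed.

Lemma derivable_erase G F Pi C : derivable G F ->
  erase G Pi -> pos_erase F C -> derivable Pi C.
Proof.
have h1 : is_true true by [].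
move=> d; elim: d Pi C => {G F} //.
- move=> i M C; have [->|/eqP ni] := eqVneq i q.
    (* The axiom for [q] becomes [OneR]: its antecedent is skipped, because no formula is read from
       a negative [q]. *)
    move=> r /pos_erase_q [h ->].
    case/match_Fm_inv: r => [[_ /erase_nil_inv ->]|]; first exact: OneR.
    move=> [_ [A [_ [_ _ nA _]]]]; move: nA.
    move E: (Var false q) => F nF; case: nF E => // -[] //= j /eqP nj [] /esym //.
  have nq : Var false i <> Var false q by case.
  case/(erase_Fm_inv nq)=> A [_ [-> nA /erase_nil_inv ->]] pC.
  have -> : A = Var true i.
    by move E: (Var false i) nA => F nF; case: nF E => // -[] //= j _ [->].
  have -> : C = Var true i.
    move E: (Var false i) pC => F pF; case: pF E => //; first by case=> /=.
    by move=> j _ [->].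
  exact: Ax.
- move=> D P A B F _ IHA _ IHB M C /match_plug_inv [D' [X [-> + rD]]] pC.
  case/match_cat_inv=> P' [Y [-> rP]].
  case/(@erase_Fm_inv (Under A B)) => // E [_ [-> nE /erase_nil_inv ->]].
  case/neg_erase_Under: nE => [[A' [B' [-> pA nB]]]|[h [-> eA eB]]|[eA nB]].
  + apply: UnderL; first exact: IHA.
    by apply: IHB pC; apply/rD/erase_Fm.
  (* For q \ q itself, the first premise reads as [P' -> 1], so [P'] is cut in; the remaining 1
     comes from [OneL], as [B = q] reads as empty. *)
  + rewrite -[P' ++ _]cat0s plug_cat; apply: (@cut_One _ h1).
      by apply: IHA => //; rewrite eA; exact: PosQ.
    rewrite plug_comp /=; apply/OneL/IHB/pC/rD; rewrite eB; exact: erase_q.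
  + rewrite -[P' ++ _]cat0s plug_cat; apply: (@cut_One _ h1).
      by apply: IHA => //; rewrite eA; exact: pos_erase_qq.
    rewrite plug_comp /=.
    by apply: IHB pC; apply/rD/erase_Fm.
- move=> P A B _ IH M C r; move E: (Under A B) => F pF; case: pF E => //.
  case=> //=.
    (* For q \ q in the succedent, premise and conclusion have the same reading, [M -> 1]. *)
    move=> h _ [eA eB]; apply: IH; last by rewrite eB; exact: PosQ.
    by rewrite eA; exact: MatchSkipL.
  move=> A' B'; rewrite negb_or => /andP[hA hB] [eA eB]; apply/UnderR/IH.
    by apply: MatchFm => //; rewrite eA; exact: NegTau.
  by rewrite eB; exact: PosTau.
- move=> D P A B F _ IHA _ IHB M C /match_plug_inv [D' [X [-> + rD]]] pC.
  case/(@erase_Fm_inv (Over B A)) => // E [P' [-> nE rP]].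
  case/neg_erase_Over: nE => [[A' [B' [-> pA nB]]]|[eA nB]].
  + apply: OverL; first exact: IHA.
    by apply: IHB pC; apply/rD/erase_Fm.
  + rewrite -[_ :: P']cats0 -cat1s -catA plug_cat; apply: (@cut_One _ h1).
      by apply: IHA => //; rewrite eA; exact: pos_erase_qq.
    rewrite plug_comp /=.
    by apply: IHB pC; apply/rD/erase_Fm.
- move=> P A B _ IH M C r; move E: (Over B A) => F pF; case: pF E => //.
  case=> //= B' A'; rewrite negb_or => /andP[hB hA] [eB eA]; apply/OverR/IH.
    by apply: match_cat => //; rewrite eA; apply/erase_Fm/NegTau.
  by rewrite eB; exact: PosTau.
- move=> D A B F _ IH M C; case/(@erase_plug_Fm_inv D (Prod A B)) => //.
  move=> D' [E [-> nE rD]] pC; move: nE.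
  move EF: (Prod A B) => G nG; case: nG EF => // -[] //= A' B'.
  rewrite negb_or => /andP[hA hB] [eA eB]; apply/ProdL/IH => //; apply: rD.
  rewrite eA eB; apply: MatchFm; first exact: NegTau.
  exact/erase_Fm/NegTau.
- move=> P G A B _ IHA _ IHB M C /match_cat_inv [P' [G' [-> rP rG]]].
  case/pos_erase_Prod=> [[A' [B' [-> pA pB]]]|[eA pB]|[eB pA]].
  + by apply: ProdR; [exact: IHA | exact: IHB].
  (* A factor q \ q reads as 1, so its antecedent is cut into the sequent read from the other
     premise. *)
  + apply: (@cut_One _ h1 P' (Hole [::] G')).
      by apply: IHA => //; rewrite eA; exact: pos_erase_qq.
    exact: IHB.
  + rewrite -[P' ++ G']cats0 -catA; apply: (@cut_One _ h1 G' (Hole P' [::])).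
      by apply: IHB => //; rewrite eB; exact: pos_erase_qq.
    by rewrite /= cats0; exact: IHA.
- move=> D A F _ IH M C; case/(@erase_plug_Fm_inv D (Dia A)) => //.
  move=> D' [E [-> nE rD]] pC; move: nE.
  move EF: (Dia A) => G nG; case: nG EF => // -[] //= A' hA [eA].
  apply/DiaL/IH => //; apply: rD; apply: MatchBr; last exact: MatchNil.
  by rewrite eA; apply/erase_Fm/NegTau.
- move=> P A _ IH M C /erase_Br_inv [P' [_ [-> rP /erase_nil_inv ->]]].
  move E: (Dia A) => F pF; case: pF E => //; first by case=> /=.
  by move=> A' hA [eA]; apply/DiaR/IH => //; rewrite eA; exact: PosTau.
- move=> D A F _ IH M C /match_plug_inv [D' [X [-> + rD]]] pC.
  case/erase_Br_inv=> H [_ [-> + /erase_nil_inv ->]].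
  case/(@erase_Fm_inv (BoxInv A)) => // E [_ [-> nE /erase_nil_inv ->]].
  (* Only the last stage [NegBox] fits, since a full negative translation of a []^{-1}-formula
     starts with [Over]. *)
  move: nE; move EF: (BoxInv A) => G nG; case: nG EF => //; first by case=> /=.
  move=> A' hA [eA]; apply/BoxInvL/IH => //; apply/rD.
  by rewrite eA; apply/erase_Fm/NegTau.
- move=> P A _ IH M C r; move E: (BoxInv A) => F pF; case: pF E => //.
  case=> //= A' hA [eA]; apply/BoxInvR/IH; last by rewrite eA; exact: PosTau.
  by apply: MatchBr => //; exact: MatchNil.
Qed.

End Erasure.

Theorem theorem1 (q : nat) (Pi : seq (item true)) (C : formula true)
  (hPi : ~~ occurs_meta q Pi) (hC : ~~ occurs q C) :
  derivable_Lb1 Pi C <-> derivable_Lb (tau_neg_meta q Pi) (tau_pos q C).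
Proof.
split=> [d|d].
- by apply: derivable_ins d _; exact: match_tau.
- apply: derivable_erase d _ (PosTau hC).
  by apply: match_sym; apply: match_tau => //; exact: NegTau.
Qed.
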